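(* For every $n\ge0$, the number of $\{uu,dd,h\}$-avoiding (alternating) GNC-trees with $n+1$ vertices is $$\sum_{i=0}^{n}(-1)^{n-i}\binom{i+1}{n-i}2^iC_i,$$ and, for $0\le r\le n$, the number of such trees with exactly $r$ ascents is $$\sum_{i+j+k=n}(-1)^{r+k}\binom{i+1}{j}\binom{2i+k}{k}\binom{k}{r-j}2^{i+k}C_i,$$ the sum over nonnegative integers $i,j,k$, where $C_i=\frac{1}{i+1}\binom{2i}{i}$ and $\binom{k}{r-j}=0$ when $r-j<0$.
   Context: A non-crossing tree on $n+1$ points: place $n+1$ points $p_0,\dots,p_n$ on a circle in counterclockwise order and draw a tree on them with straight edges inside the circle, no two crossing. A (rooted) GNC-tree with $n+1$ vertices is such a tree with a labelling of the points by positive integers, weakly increasing along $p_0,\dots,p_n$, $p_0$ labelled 1, label set $\{1,\dots,m\}$ for some $m$; rooted at $p_0$. Orient each edge from parent (closer to root) to child; it is an ascent ($u$) if parent label $<$ child label, a level ($h$) if equal, a descent ($d$) if larger. Each root-to-vertex path gives a word over $\{u,h,d\}$; a tree contains $\sigma$ if some such word contains $\sigma$ as a contiguous factor. A $\{uu,dd,h\}$-avoiding GNC-tree is one containing none of $uu$, $dd$, $h$. *)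

(* Defs.v *)
From HB Require Import structures.
From mathcomp Require Import all_boot all_order all_algebra.

Set Implicit Arguments.
Unset Strict Implicit.
Unset Printing Implicit Defensive.

Variant letter := asc | lev | desc.

Definition letter_code (s : letter) : 'I_3 :=
  match s with asc => inord 0 | lev => inord 1 | desc => inord 2 end.
Definition letter_decode (i : 'I_3) : letter :=
  match val i with 0 => asc | 1 => lev | _ => desc end.
Lemma letter_codeK : cancel letter_code letter_decode.
Proof. by case; rewrite /letter_decode /letter_code /= inordK. Qed.
HB.instance Definition _ := Equality.copy letter (can_type letter_codeK).

(* The point p_i is i : 'I_n.+1; an undirected edge is a 2-element set. *)
Definition graph (n : nat) := {set {set 'I_n.+1}}.

Definition simple_graph n (E : graph n) : bool := [forall e in E, #|e| == 2].

Definition adj n (E : graph n) : rel 'I_n.+1 := fun x y => [set x; y] \in E.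

Definition connected n (E : graph n) : bool :=
  [forall x, forall y, connect (adj E) x y].

(* A cycle is a cyclic sequence of at least 3 distinct vertices; distinctness
   bounds its length by n.+1, so that quantifying over k < n.+2 is no
   restriction. *)
Definition acyclic n (E : graph n) : bool :=
  [forall k : 'I_n.+2, forall c : k.-tuple 'I_n.+1,
     (2 < k) ==> ~~ ucycleb (adj E) c].

Definition is_tree n (E : graph n) : bool :=
  [&& simple_graph E, connected E & acyclic E].

(* The points are in cyclic order on the circle, so the chords ab (a < b) and
   cd (c < d) cross iff a < c < b < d, up to exchanging the two chords. *)
Definition noncrossing n (E : graph n) : bool :=
  [forall a : 'I_n.+1, forall b : 'I_n.+1,
   forall c : 'I_n.+1, forall d : 'I_n.+1,
     [&& a < c, c < b & b < d] ==> ~~ (adj E a b && adj E c d)].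

(* Labels range over 'I_n.+2 to make the set of labellings finite: by
   [label_bound] a labelling with label set {1, ..., m} has m <= n.+1. *)
Definition labelling (n : nat) := {ffun 'I_n.+1 -> 'I_n.+2}.

Lemma label_bound n (f : 'I_n.+1 -> nat) m :
  (forall k, (exists x, f x = k) <-> 0 < k <= m) -> m <= n.+1.
Proof.
move=> fE; have := @uniq_leq_size _ (iota 1 m) (codom f) (iota_uniq 1 m).
rewrite size_iota size_codom card_ord; apply=> k.
rewrite mem_iota add1n ltnS => /fE[x <-].
exact: codom_f.
Qed.

Definition gnc_labelling n (l : labelling n) : bool :=
  [&& [forall x : 'I_n.+1, forall y : 'I_n.+1, (x <= y) ==> (l x <= l y)],
      l ord0 == 1 :> nat
    & [exists m : 'I_n.+2,
         [set l x | x : 'I_n.+1] == [set k : 'I_n.+2 | 0 < k <= m]]].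

Definition lgraph (n : nat) := (graph n * labelling n)%type.

Definition is_gnc n (T : lgraph n) : bool :=
  [&& is_tree T.1, noncrossing T.1 & gnc_labelling T.2].

(* Graph distance from the root p_0 (the value is n.+1 if x is unreachable,
   which does not occur in a tree). *)
Definition dist n (E : graph n) (x : 'I_n.+1) : nat :=
  find (fun k => [exists p : k.-tuple 'I_n.+1,
                    path (adj E) ord0 p && (last ord0 p == x)])
       (iota 0 n.+1).

(* x is the parent of y: the edge xy, oriented away from the root. *)
Definition parent n (E : graph n) : rel 'I_n.+1 :=
  fun x y => adj E x y && (dist E x < dist E y).

Definition step n (l : labelling n) (x y : 'I_n.+1) : letter :=
  if l x < l y then asc else if l x == l y then lev else desc.

(* Some downward path from the root has a word with s as a contiguous factor.
   The distance to the root increases along such a path, so it has at most n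
   edges and quantifying over k < n.+1 is no restriction. *)
Definition contains n (T : lgraph n) (s : seq letter) : bool :=
  [exists k : 'I_n.+1, exists p : k.-tuple 'I_n.+1,
     path (parent T.1) ord0 p && infix s (pairmap (step T.2) ord0 p)].

Definition avoids n (T : lgraph n) (S : seq (seq letter)) : bool :=
  all (fun s => ~~ contains T s) S.

Definition alternating_gnc (n : nat) : {set lgraph n} :=
  [set T | is_gnc T &
           avoids T [:: [:: asc; asc]; [:: desc; desc]; [:: lev]]].

Definition ascents n (T : lgraph n) : nat :=
  #|[set e : 'I_n.+1 * 'I_n.+1 |
       parent T.1 e.1 e.2 && (step T.2 e.1 e.2 == asc)]|.

Definition catalan (i : nat) : rat :=
  ((i.+1%:R)^-1 * 'C(i.*2, i)%:R)%R.

(* Main.v *)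
Require Import Defs.
From HB Require Import structures.
From mathcomp Require Import all_boot all_order all_algebra zify ring.
Set Implicit Arguments.
Unset Strict Implicit.
Unset Printing Implicit Defensive.

(* In an alternating tree every edge joins a vertex at even distance from the
   root to one at odd distance, and the former has the smaller label; as labels
   increase weakly along the circle, no vertex has both a smaller and a larger
   neighbour.  A connected non-crossing graph on the points a..b (a < b) with
   this last property contains the edge ab, and its other edges split between
   a..k and k+1..b, where k < b is the largest neighbour of a (or a itself).
   Hence such graphs on n+1 points are binary trees with n nodes, the nodes
   corresponding in infix order to the gaps between consecutive points.  A
   labelling is a choice of the gaps where the label increases, forced to
   contain the gaps spanned by an edge, i.e. the nodes without children.
   Ascents are counted by their upper ends, the vertices with a smaller
   neighbour.  So the generating function F(x, t) satisfies
   F = 1 + x (2 F (F + t - 1) - t), whose solution is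
   F = u g C(2 x u g^2) with u = 1 - x t, g = 1 / (1 + 2 x (1 - t)) and C the
   Catalan series; expanding gives the second formula, and t = 1 the first. *)

(** * Binary trees and their edge sets *)

(* A node stands for the longest edge ab on the points a..b together with the
   gap between k and k+1 at which the remaining edges split; [s] tells whether
   the label increases at that gap. *)
Inductive btree := Leaf | Node (s : bool) (l r : btree).

Fixpoint btree_code (t : btree) : GenTree.tree bool :=
  if t is Node s l r then GenTree.Node s [:: btree_code l; btree_code r]
  else GenTree.Leaf true.

Fixpoint btree_decode (c : GenTree.tree bool) : option btree :=
  match c with
  | GenTree.Node s [:: l; r] =>
      match btree_decode l, btree_decode r with
      | Some l', Some r' => Some (Node (s == 1) l' r')
      | _, _ => None
      end
  | _ => Some Leaf
  end.

Lemma btree_codeK : pcancel btree_code btree_decode.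
Proof. by elim=> //= s l -> r ->; case: s. Qed.

HB.instance Definition _ := Equality.copy btree (pcan_type btree_codeK).

Fixpoint nodes (t : btree) : nat :=
  if t is Node _ l r then (nodes l + nodes r).+1 else 0.

Fixpoint marks (t : btree) : seq bool :=
  if t is Node s l r then marks l ++ s :: marks r else [::].

Fixpoint edges (t : btree) (a : nat) : seq (nat * nat) :=
  if t is Node _ l r then
    (a, a + (nodes l + nodes r).+1) :: edges l a ++ edges r (a + nodes l).+1
  else [::].

(** The edge of a childless node joins neighbouring points, so the label must increase at its only
    gap; at every other node the mark is free. *)
Fixpoint valid (t : btree) : bool :=
  if t is Node s l r then [&& s || (0 < nodes l + nodes r), valid l & valid r]
  else true.

(* The number of points with a smaller neighbour: the single point of an empty
   right subtree is one because of the edge above it. *)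
Fixpoint highs (t : btree) : nat :=
  if t is Node _ l r then highs l + (if r is Leaf then 1 else highs r) else 0.

Lemma size_marks t : size (marks t) = nodes t.
Proof. by elim: t => //= s l IHl r IHr; rewrite size_cat /= IHl IHr addnS. Qed.

Lemma edges_bound t a x y :
  (x, y) \in edges t a -> [&& a <= x, x < y & y <= a + nodes t].
Proof.
elim: t a x y => //= s l IHl r IHr a x y; rewrite inE mem_cat.
case/or3P=> [/eqP[-> ->]|/IHl|/IHr]; lia.
Qed.

Lemma mem_edges_top t a : 0 < nodes t -> (a, a + nodes t) \in edges t a.
Proof. by case: t => //= s l r _; rewrite mem_head. Qed.

Lemma edges_noncrossing t a x y x' y' :
  (x, y) \in edges t a -> (x', y') \in edges t a ->
  x < x' -> x' < y -> y < y' -> False.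
Proof.
elim: t a x y x' y' => //= s l IHl r IHr a x y x' y'; rewrite !inE !mem_cat.
case/or3P=> [/eqP[e1 e2]|h|h]; case/or3P=> [/eqP[e3 e4]|h'|h'].
all: try (have := edges_bound h); try (have := edges_bound h'); try lia.
all: move=> _ _.
all: first [exact: (IHl _ _ _ _ _ h h') | exact: (IHr _ _ _ _ _ h h')].
Qed.

Lemma edges_alternating t a x y z :
  (x, y) \in edges t a -> (y, z) \in edges t a -> False.
Proof.
elim: t a x y z => //= s l IHl r IHr a x y z; rewrite !inE !mem_cat.
case/or3P=> [/eqP[e1 e2]|h|h]; case/or3P=> [/eqP[e3 e4]|h'|h'].
all: try (have := edges_bound h); try (have := edges_bound h'); try lia.
all: move=> _ _.
all: first [exact: (IHl _ _ _ _ h h') | exact: (IHr _ _ _ _ h h')].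
Qed.

(* Connectedness of the restriction of [R] to [a, b], stated by cuts. *)
Definition interval_connected (R : rel nat) (a b : nat) : Prop :=
  forall S : pred nat,
    (forall x y, a <= x -> y <= b -> R x y -> S x = S y) ->
    forall x, a <= x <= b -> S x = S a.

Definition edge_rel t a : rel nat := fun x y => (x, y) \in edges t a.

(** The two halves are connected by induction, and the top edge joins the first point of the left
    half to the last point of the right half. *)
Lemma edges_connected t a :
  interval_connected (edge_rel t a) a (a + nodes t).
Proof.
elim: t a => [|s l IHl r IHr] a S Sinv x /=; first by move=> ?; congr S; lia.
have Sl z : a <= z <= a + nodes l -> S z = S a.
  apply: IHl => u v ? ? uv; apply: Sinv => //=; first lia.
  by rewrite /edge_rel /= inE mem_cat [(u, v) \in _]uv orbT.
have Sr z : (a + nodes l).+1 <= z <= (a + nodes l).+1 + nodes r ->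
    S z = S (a + nodes l).+1.
  apply: IHr => u v ? ? uv; apply: Sinv => //=; try lia.
  by rewrite /edge_rel /= inE mem_cat [(u, v) \in edges r _]uv !orbT.
have Sab : S a = S (a + (nodes l + nodes r).+1).
  by apply: Sinv => //; rewrite /edge_rel /= mem_head.
move=> xab; case: (leqP x (a + nodes l)) => xl; first by apply: Sl; lia.
rewrite Sr; last lia.
by rewrite Sab (Sr (a + (nodes l + nodes r).+1)) //; lia.
Qed.

(** This makes labels strictly increase along edges. A marked root provides its own gap; below an
    unmarked root validity gives a nonempty subtree, whose top edge lies within the root edge and
    spans a marked gap by induction. *)
Lemma edges_mark t a x y : valid t -> (x, y) \in edges t a ->
  exists2 i, x <= i < y & nth false (marks t) (i - a).
Proof.
elim: t a x y => //= s l IHl r IHr a x y /and3P[hs vl vr]; rewrite inE mem_cat.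
have nthl i : i < a + nodes l -> a <= i ->
    nth false (marks l ++ s :: marks r) (i - a) = nth false (marks l) (i - a).
  by move=> ? ?; rewrite nth_cat size_marks ifT //; lia.
have nthr i : a + nodes l < i ->
    nth false (marks l ++ s :: marks r) (i - a) =
    nth false (marks r) (i - (a + nodes l).+1).
  move=> ?; rewrite nth_cat size_marks ifF; last lia.
  by rewrite (_ : i - a - nodes l = (i - (a + nodes l).+1).+1) //; lia.
have hl u v : (u, v) \in edges l a -> exists2 i, u <= i < v &
    nth false (marks l ++ s :: marks r) (i - a).
  move=> h; have [i ui hi] := IHl _ _ _ vl h; exists i => //.
  by have hb := edges_bound h; rewrite nthl //; lia.
have hr u v : (u, v) \in edges r (a + nodes l).+1 -> exists2 i, u <= i < v &
    nth false (marks l ++ s :: marks r) (i - a).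
  move=> h; have [i ui hi] := IHr _ _ _ vr h; exists i => //.
  by have hb := edges_bound h; rewrite nthr //; lia.
case/or3P=> [/eqP[-> ->]|/hl//|/hr//].
case: s hs hl hr {nthl nthr} => /= [_ _ _|hs hl hr].
  exists (a + nodes l); first lia.
  by rewrite addKn nth_cat size_marks ltnn subnn.
have [l0|l0] := posnP (nodes l).
  have [|i ? ?] := hr _ _ (mem_edges_top (a + nodes l).+1 (t := r) _).
    by lia.
  by exists i => //; lia.
by have [i ? ?] := hl _ _ (mem_edges_top a l0); exists i => //; lia.
Qed.

Lemma edges_left s l r a x y :
  ((x, y) \in edges l a) =
  ((x, y) \in edges (Node s l r) a) && (y <= a + nodes l).
Proof.
rewrite /= inE mem_cat; apply/idP/andP=> [h|[/or3P[/eqP[-> ->]|//|h]]].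
- by rewrite h orbT; have := edges_bound h; lia.
- lia.
- by have := edges_bound h; lia.
Qed.

Lemma edges_right s l r a x y :
  ((x, y) \in edges r (a + nodes l).+1) =
  ((x, y) \in edges (Node s l r) a) && (a + nodes l < x).
Proof.
rewrite /= inE mem_cat; apply/idP/andP=> [h|[/or3P[/eqP[-> ->]|h|//]]].
- by rewrite h !orbT; have := edges_bound h; lia.
- lia.
- by have := edges_bound h; lia.
Qed.

(** The edges determine the split: if [l'] were larger than [l], its top edge would be too short for
    the root edge of the first tree, too long for [l], and would start too far left for [r]. *)
Lemma nodes_left_le s l r s' l' r' a :
  nodes (Node s l r) = nodes (Node s' l' r') ->
  edges (Node s l r) a =i edges (Node s' l' r') a -> nodes l' <= nodes l.
Proof.
move=> eqn eqE; rewrite leqNgt; apply/negP=> lt_l.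
have h : (a, a + nodes l') \in edges (Node s l r) a.
  by rewrite eqE /= inE mem_cat mem_edges_top ?orbT //; lia.
move: h eqn; rewrite /= inE mem_cat; case/or3P=> [/eqP[]|h|h]; first lia.
all: by have := edges_bound h; lia.
Qed.

Lemma edges_marks_inj t t' a : nodes t = nodes t' ->
  edges t a =i edges t' a -> marks t = marks t' -> t = t'.
Proof.
elim: t t' a => [|s l IHl r IHr] [|s' l' r'] // a eqn eqE.
move: (eqn) => /= /eqP; rewrite eqSS => /eqP eqn' eqm.
have eql : nodes l = nodes l'.
  apply/eqP; rewrite eqn_leq (@nodes_left_le s' l' r' s l r a) //.
  by rewrite (@nodes_left_le s l r s' l' r' a).
have eqr : nodes r = nodes r' by lia.
have /andP[/eqP ml /eqP [-> mr]] :
    (marks l == marks l') && (s :: marks r == s' :: marks r').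
  by rewrite -eqseq_cat ?size_marks ?eql // eqm.
congr Node; first apply: (IHl _ a) => // -[x y].
  by rewrite (edges_left s l r) (edges_left s' l' r') eqE eql.
apply: (IHr _ (a + nodes l).+1) => // -[x y].
by rewrite (edges_right s l) eql (edges_right s' l') -eqE.
Qed.

(** * Decomposition of a connected non-crossing alternating relation *)

Section Surjectivity.

Variable R : rel nat.
Hypothesis R_lt : forall x y, R x y -> x < y.
Hypothesis R_nc : forall x y x' y',
  R x y -> R x' y' -> x < x' -> x' < y -> y < y' -> False.
Hypothesis R_alt : forall x y z, R x y -> R y z -> False.

(** An edge from strictly between [a] and [k] to beyond [k] would cross the edge [ak], and one
    starting at [k] would break alternation. So it starts at [a], and the maximality of [k] leaves
    only the end [b]. *)
Lemma cut_edge a b k x y : (k = a \/ R a k) ->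
    (forall z, R a z -> z <= b -> z <= k \/ z = b) ->
  a <= x -> x <= k -> k < y -> y <= b -> R x y -> x = a /\ y = b.
Proof.
move=> ak kmax ax xk ky yb xy.
have [xa|xa] := eqVneq x a.
  by split=> //; rewrite xa in xy; have [//|] := kmax y xy yb; lia.
exfalso; case: ak => [?|ak]; first lia.
have [xk'|xk'] := eqVneq x k; first by subst; exact: (R_alt ak xy).
by apply: (R_nc ak xy); lia.
Qed.

Lemma max_neighbour a b :
  exists2 k, (k = a \/ R a k /\ k < b) &
             forall z, R a z -> z < b -> z <= k.
Proof.
have [|no] := boolP (has (fun z => R a z) (iota 0 b)).
  move/hasP=> [z0]; rewrite mem_iota => /andP[_ z0b] az0.
  have ex : exists z, R a z && (z < b) by exists z0; rewrite az0.
  have ub z : R a z && (z < b) -> z <= b by case/andP=> _ /ltnW.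
  case: (ex_maxnP ex ub) => k /andP[ak kb] kmax; exists k; first by right.
  by move=> z az zb; apply: kmax; rewrite az.
exists a; first by left.
move=> z az zb; case/hasP: no; exists z => //; rewrite mem_iota; lia.
Qed.

Lemma top_edge a b : a < b -> interval_connected R a b -> R a b.
Proof.
(* The bound [b.+1] admits [b] itself as a neighbour. If the largest one [k] falls short of [b], no
   edge within [a..b] leaves [a..k], against connectedness. *)
move=> ab conn; have [k ak kmax] := max_neighbour a b.+1.
have kb : k <= b by case: ak => [->|[]]; lia.
have [kb'|kb'] := eqVneq k b.
  by case: ak => [?|[]]; [lia|rewrite kb'].
suff : (b <= k) = (a <= k) by case: ak => [|[/R_lt]]; lia.
apply: (conn (fun x => x <= k)); last lia.
move=> x y ax yb xy /=; have := R_lt xy.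
have [xk|xk] := leqP x k; have [yk|yk] := leqP y k => //; try lia.
move=> _; have [] := @cut_edge a b k x y _ _ ax xk yk yb xy => //.
- by case: ak => [->|[]]; [left|right].
- by move=> z az zb; left; apply: kmax.
- by move=> xa yb'; subst; have := kmax b xy (ltnSn b); lia.
Qed.

Lemma split_connected a b : a < b -> interval_connected R a b ->
  exists k, [/\ a <= k < b, interval_connected R a k,
    interval_connected R k.+1 b &
    forall x y, a <= x -> y <= b -> R x y ->
      [\/ x = a /\ y = b, y <= k | k < x]].
Proof.
move=> ab conn; have Rab := top_edge ab conn.
have [k ak kmax] := max_neighbour a b.
have kab : a <= k < b by case: ak => [->|[/R_lt]]; lia.
have cut x y : a <= x -> y <= b -> R x y -> [\/ x = a /\ y = b, y <= k | k < x].
  move=> ax yb xy; have [xk|xk] := leqP x k; last by constructor 3.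
  have [yk|yk] := leqP y k; first by constructor 2.
  constructor 1; apply: (@cut_edge a b k) => //.
    by case: ak => [->|[]]; [left|right].
  move=> z az; rewrite leq_eqVlt.
  by move=> /predU1P[->|/(kmax _ az)->]; [right|left].
exists k; split=> //.
- move=> S Sinv x xa.
  (* A cut of the left half extends to the whole interval by the constant [S a] on the right, so
     that the edge [ab] respects it. *)
  have := conn (fun z => if z <= k then S z else S a) _ x.
  have -> : a <= k by lia.
  rewrite ifT; last lia.
  apply; last lia.
  move=> u v ua vb uv; have [] := cut u v ua vb uv.
  + by case=> -> ->; rewrite [b <= k](_ : _ = false) ?if_same //; lia.
  + by move=> vk; have ? := R_lt uv; rewrite vk ifT ?(Sinv u v) //; lia.
  + by move=> ku; have ? := R_lt uv; rewrite !ifF //; lia.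
- move=> S Sinv x xa.
  (* Symmetrically, a cut of the right half is extended by the constant [S b] on the left. *)
  have H z : a <= z <= b -> (if z <= k then S b else S z) = S b.
    move=> zab.
    have := conn (fun z => if z <= k then S b else S z) _ z zab.
    have -> : a <= k by lia.
    apply.
    move=> u v ua vb uv; have [] := cut u v ua vb uv.
    + by case=> -> ->; rewrite if_same ifT //; lia.
    + by move=> vk; have ? := R_lt uv; rewrite vk ifT //; lia.
    + by move=> ku; have ? := R_lt uv; rewrite !ifF ?(Sinv u v) //; lia.
  have := H x; have := H k.+1; rewrite ltnn [x <= k](_ : _ = false); last lia.
  by move=> -> => [->|]; lia.
Qed.

Variable g : pred nat.
Hypothesis g_short : forall i, R i i.+1 -> g i.

(** Strong induction along [split_connected]; each node records the value of [g] at its gap [k]. A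
    node is childless only for an edge between consecutive points, where [g_short] supplies the mark
    that [valid] demands. *)
Lemma btree_of_rel m a : interval_connected R a (a + m) ->
  exists t, [/\ nodes t = m, valid t,
    marks t = [seq g i | i <- iota a m] &
    forall x y, ((x, y) \in edges t a) = [&& a <= x, y <= a + m & R x y]].
Proof.
elim/ltn_ind: m a => -[|m] IH a conn.
  exists Leaf; split=> // x y; rewrite in_nil; apply/esym/negP.
  by case/and3P=> ax ya /R_lt; lia.
have ab : a < a + m.+1 by lia.
have [k [kab cl cr cut]] := split_connected ab conn.
have El : a + (k - a) = k by lia.
have Er : k.+1 + (a + m - k) = a + m.+1 by lia.
have [||l [nl vl ml el]] := IH (k - a) _ a; [lia|by rewrite El|].
have [||r [nr vr mr er]] := IH (a + m - k) _ k.+1; [lia|by rewrite Er|].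
have Eal : (a + nodes l).+1 = k.+1 by lia.
have Rab := top_edge ab conn.
exists (Node (g k) l r); split=> /=.
- lia.
- rewrite vl vr !andbT nl nr.
  have [e0|_] := posnP (k - a + (a + m - k)); last by rewrite orbT.
  have Ek : k.+1 = a + m.+1 by lia.
  by rewrite orbF; apply: g_short; rewrite Ek; have -> : k = a by lia.
- rewrite -[RHS]/(map g (iota a m.+1)) ml mr.
  have -> : m.+1 = (k - a) + (a + m - k).+1 by lia.
  by rewrite iotaD map_cat /= El.
- move=> x y; rewrite Eal inE mem_cat el er El Er nl nr.
  have Ea : a + (k - a + (a + m - k)).+1 = a + m.+1 by lia.
  rewrite Ea.
  apply/idP/idP.
    case/or3P=> [/eqP[-> ->]|/and3P[? ? ->]|/and3P[? ? ->]]; last 2 first.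
    + lia.
    + lia.
    by rewrite Rab; lia.
  case/and3P=> ax ym xy; have [] := cut x y ax ym xy.
  + by case=> -> ->; rewrite eqxx.
  + by move=> yk; rewrite ax yk xy !orbT.
  + by move=> kx; rewrite kx ym xy !orbT.
Qed.

End Surjectivity.

Definition is_high t a x := has (fun e : nat * nat => e.2 == x) (edges t a).

Lemma count_highs t a :
  count (is_high t a) (iota a (nodes t).+1) = highs t.
Proof.
elim: t a => // s l IHl r IHr a.
have -> : (nodes (Node s l r)).+1 = (nodes l).+1 + (nodes r).+1.
  by rewrite /= addSn addnS.
have outside t b x : is_high t b x -> b < x <= b + nodes t.
  by case/hasP=> -[u v] /edges_bound ? /= /eqP <-; lia.
rewrite iotaD count_cat [RHS]/=; congr (_ + _).
  rewrite -[RHS](IHl a); apply: eq_in_count => x; rewrite mem_iota => xa.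
  rewrite /is_high /= has_cat -/(is_high l a x) -/(is_high r _ x).
  rewrite [is_high r _ x](_ : _ = false) ?orbF; last first.
    by apply/negP=> /outside; lia.
  by rewrite (_ : (_ == x) = false) //; lia.
set k := (a + nodes l).+1.
transitivity (count (fun x => (x == k + nodes r) || is_high r k x)
                (iota k (nodes r).+1)).
  rewrite addnS; apply: eq_in_count => x; rewrite mem_iota => xa.
  rewrite /is_high /= has_cat -/(is_high l a x) -/(is_high r _ x).
  rewrite [is_high l _ x](_ : _ = false) /=; last first.
    by apply/negP=> /outside; lia.
  by rewrite eq_sym; congr orb; lia.
(* The top edge of a nonempty right subtree already ends at the last point, so the root edge adds no
   new right end. *)
case: r IHr => [_|s' l' r' IHr]; first by rewrite /= orbF; lia.
rewrite -(IHr (a + nodes l).+1); apply: eq_in_count => x _.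
have [->|//] := eqVneq x; apply/esym/hasP.
by exists ((a + nodes l).+1, (a + nodes l).+1 + nodes (Node s' l' r'));
  rewrite ?mem_edges_top /=.
Qed.

(** * Enumeration of the valid binary trees *)

Definition splits (f : nat -> seq btree) (n : nat) : seq (btree * btree) :=
  flatten [seq [seq (l, r) | l <- f k, r <- f (n - k)] | k <- iota 0 n.+1].
Arguments splits : simpl never.

(* The trees with [n] nodes, provided the fuel [m] is at least [n]. *)
Fixpoint btrees (m n : nat) : seq btree :=
  match n, m with
  | 0, _ => [:: Leaf]
  | n'.+1, m'.+1 =>
      [seq Node s lr.1 lr.2 | lr <- splits (btrees m') n',
         s <- if n' == 0 then [:: true] else [:: true; false]]
  | _, _ => [::]
  end.

Lemma mem_splits f n lr :
  lr \in splits f n =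
  has (fun k => (lr.1 \in f k) && (lr.2 \in f (n - k))) (iota 0 n.+1).
Proof.
apply/flattenP/hasP => [[ps /mapP[k kn ->]]|[k kn /andP[hl hr]]].
  by case/allpairsP=> -[l r] [hl hr ->]; exists k; rewrite ?hl.
exists [seq (l, r) | l <- f k, r <- f (n - k)]; first by apply/mapP; exists k.
by case: lr hl hr => l r hl hr; apply: allpairs_f.
Qed.

Lemma mem_btrees m n t : n <= m ->
  (t \in btrees m n) = valid t && (nodes t == n).
Proof.
elim: m n t => [|m IH] [|n] t nm //=.
- by rewrite inE; case: t => //= s l r; rewrite andbF.
- by rewrite inE; case: t => //= s l r; rewrite andbF.
apply/allpairsP/idP => [[[[l r] s] /= []]|].
  rewrite mem_splits => /hasP[k]; rewrite mem_iota /= => kn /andP[].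
  rewrite !IH; [|lia..] => /andP[vl /eqP nl] /andP[vr /eqP nr] hs -> /=.
  rewrite vl vr nl nr !andbT; move: hs; case: ifP => n0; rewrite !inE.
    by move/eqP->; rewrite /=; lia.
  by move=> _; lia.
case: t => [|s l r] //= /andP[/and3P[hs vl vr] /eqP[nlr]].
exists ((l, r), s); split=> //=.
  rewrite mem_splits; apply/hasP.
  exists (nodes l); first by rewrite mem_iota; lia.
  by rewrite /= !IH ?vl ?vr /=; lia.
by move: hs; rewrite nlr; case: s; case: ifP => // /eqP ->.
Qed.

Lemma btrees_uniq m n : n <= m -> uniq (btrees m n).
Proof.
elim: m n => [|m IH] [|n] nm //=.
apply: allpairs_uniq => /=; last 2 first.
- by case: ifP.
- by move=> [[l r] s] [[l' r'] s'] /= _ _ [-> -> ->].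
have : {in iota 0 n.+1, forall k, k <= n} by move=> k; rewrite mem_iota; lia.
rewrite /splits; elim: (iota 0 n.+1) (iota_uniq 0 n.+1) => //= k ks IHk.
move=> /andP[kks uks] kn.
have kn' : k <= n by apply: kn; rewrite mem_head.
rewrite cat_uniq; apply/and3P; split.
- by apply: allpairs_uniq; [apply: IH; lia..|move=> [? ?] [? ?]].
(* Lists for different [k] are disjoint because [k] is the number of nodes of the left component. *)
- apply/hasPn=> -[l r] /flattenP[_ /mapP[k' k'ks ->]].
  have k'n : k' <= n by apply: kn; rewrite inE k'ks orbT.
  case/allpairsP=> -[l' r'] /= [hl _ [-> _]]; apply/negP.
  case/allpairsP=> -[l2 r2] /= [hl2 _ [e _]]; subst l2.
  move: hl hl2; rewrite !mem_btrees; [|lia..].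
  move=> /andP[_ /eqP e1] /andP[_ /eqP e2].
  by rewrite (_ : k = k') ?k'ks in kks; last congruence.
- by apply: IHk => // j js; apply: kn; rewrite inE js orbT.
Qed.

(** * Trees avoiding the three patterns *)

Section Trees.

Variable n : nat.
Implicit Types (E : graph n) (x y z w : 'I_n.+1).

Lemma size_uniq_ord (s : seq 'I_n.+1) : uniq s -> size s <= n.+1.
Proof. by move/card_uniqP <-; rewrite -[X in _ <= X]card_ord max_card. Qed.

Lemma adjC E x y : adj E x y = adj E y x.
Proof. by rewrite /adj setUC. Qed.

Lemma adj_neq E x y : simple_graph E -> adj E x y -> x != y.
Proof. by move=> /forall_inP sE /sE; rewrite cards2; case: (x =P y). Qed.

(** An edge of [E] outside [P] would close a repetition-free [P]-path between its ends to a cycle of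
    [E]. *)
Lemma acyclic_spanning E (P : rel 'I_n.+1) :
    simple_graph E -> acyclic E -> subrel P (adj E) ->
    (forall x y, connect P x y) ->
  forall x y, adj E x y -> P x y.
Proof.
move=> sE aE PE conP x y exy; apply: contraT => nP.
have /connectP[p pth ly] := conP x y.
case/shortenP: pth ly => p' pth' up' _ ly.
have sz : size (x :: p') < n.+2.
  by rewrite ltnS size_uniq_ord.
move/forallP: aE => /(_ (Ordinal sz)) /forallP /(_ (in_tuple (x :: p'))).
move/implyP.
(* The ends of an edge differ, and a path with a single step would put the pair [x], [y] in [P]. *)
have -> : 2 < size (x :: p').
  clear sz up'.
  case: p' pth' ly => [|a [|b p']] //= => [_ e|].
    by have := adj_neq sE exy; rewrite e eqxx.
  by rewrite andbT => Pxa e; rewrite e Pxa in nP.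
move=> /(_ isT); rewrite /ucycleb up' andbT /= rcons_path -ly adjC exy andbT.
by rewrite (sub_path PE pth').
Qed.

(** A walk shortened to visit no vertex twice has at most [n] edges, so the bounded search in [dist]
    succeeds. *)
Lemma dist_path E x : connected E ->
  exists p, [/\ size p = dist E x, path (adj E) ord0 p & last ord0 p = x].
Proof.
move=> /forallP/(_ ord0)/forallP/(_ x)/connectP[p pth lx].
case/shortenP: pth lx => p' pth' up' _ lx.
pose a k := [exists q : k.-tuple 'I_n.+1,
  path (adj E) ord0 q && (last ord0 q == x)].
have hasa : has a (iota 0 n.+1).
  apply/hasP; exists (size p').
    by rewrite mem_iota /= add0n (size_uniq_ord up').
  by apply/existsP; exists (in_tuple p'); rewrite /= pth' -lx eqxx.
have := nth_find 0 hasa; rewrite nth_iota; last first.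
  by rewrite has_find size_iota in hasa.
by case/existsP=> q /andP[pq /eqP lq]; exists q; rewrite size_tuple.
Qed.

Lemma dist_le E x p :
  path (adj E) ord0 p -> last ord0 p = x -> dist E x <= size p.
Proof.
move=> pth lx; rewrite leqNgt; apply/negP => lt_p.
have := before_find 0 lt_p; rewrite nth_iota; last first.
  apply: leq_trans lt_p _.
  by rewrite /dist -[X in _ <= X](size_iota 0) find_size.
move/negbT/negP; apply; apply/existsP; exists (in_tuple p).
by rewrite /= pth lx eqxx.
Qed.

Lemma dist_root E : dist E ord0 = 0.
Proof. by apply/eqP; rewrite -leqn0 (@dist_le E ord0 [::]). Qed.

Lemma dist_adj E x y : connected E -> adj E x y -> dist E y <= (dist E x).+1.
Proof.
move=> cE xy; have [p [<- pth lx]] := dist_path x cE.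
by rewrite -(size_rcons p y) dist_le ?last_rcons // rcons_path pth lx.
Qed.

Lemma dist_pred E x : connected E -> x != ord0 ->
  exists w, adj E w x && (dist E x == (dist E w).+1).
Proof.
move=> cE x0; have [p [sp pth lx]] := dist_path x cE.
case/lastP: p sp pth lx => [|p w] sp pth lx; first by rewrite -lx eqxx in x0.
move: pth lx sp; rewrite rcons_path last_rcons size_rcons => /andP[pth lw] wx.
rewrite wx in lw * => sp; exists (last ord0 p); rewrite lw eqn_leq.
by rewrite (dist_adj cE lw) -sp ltnS dist_le.
Qed.

(* Choosing one parent for each vertex gives a connected subgraph of [E], which
   by acyclicity is all of [E]. *)
Lemma tree_parents E : is_tree E ->
  exists2 par : 'I_n.+1 -> 'I_n.+1,
    forall x y, parent E x y = (y != ord0) && (x == par y) &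
    (forall x, x != ord0 -> adj E (par x) x /\ dist E x = (dist E (par x)).+1)
    /\ forall x y, adj E x y -> parent E x y || parent E y x.
Proof.
case/and3P=> sE cE aE.
pose par x := odflt ord0 [pick w | adj E w x && (dist E x == (dist E w).+1)].
have parP x : x != ord0 -> adj E (par x) x /\ dist E x = (dist E (par x)).+1.
  move=> x0; rewrite /par; case: pickP => [w /andP[-> /eqP]//|no].
  by have [w] := dist_pred cE x0; rewrite no.
pose P x y := (y != ord0) && (x == par y) || (x != ord0) && (y == par x).
have Psym : symmetric P by move=> x y; rewrite /P orbC.
have PE : subrel P (adj E).
  by move=> x y /orP[] /andP[/parP[h _] /eqP ->] //; rewrite adjC.
have con0 x : connect P ord0 x.
  have [m] := ubnP (dist E x); elim: m x => // m IH x; rewrite ltnS => xm.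
  have [->|x0] := eqVneq x ord0; first exact: connect0.
  have [_ dx] := parP x x0; apply: (@connect_trans _ _ (par x)).
    by apply: IH; rewrite dx in xm.
  by apply: connect1; rewrite /P x0 eqxx.
have conP x y : connect P x y.
  by rewrite (connect_trans _ (con0 y)) // sym_connect_sym.
have EP := acyclic_spanning sE aE PE conP.
have parE x y : parent E x y = (y != ord0) && (x == par y).
  apply/andP/andP => [[xy lt]|[y0 /eqP ->]]; last first.
    by have [? ->] := parP y y0.
  case/orP: (EP _ _ xy) => /andP[// x0 /eqP yx].
  by have [_] := parP x x0; rewrite -yx; lia.
exists par => //; split=> // x y /EP /orP[] h; rewrite !parE h //.
by rewrite orbT.
Qed.

Lemma adj_dist E x y : is_tree E -> adj E x y ->
  dist E y = (dist E x).+1 \/ dist E x = (dist E y).+1.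
Proof.
move=> /tree_parents[par parE [parP tot]] /tot.
by case/orP; rewrite parE => /andP[/parP[_ d] /eqP ->]; [left|right].
Qed.

Lemma parent_path E x : is_tree E ->
  exists2 p, path (parent E) ord0 p & last ord0 p = x.
Proof.
move=> /tree_parents[par parE [parP _]].
have [m] := ubnP (dist E x); elim: m x => // m IH x; rewrite ltnS => xm.
have [->|x0] := eqVneq x ord0; first by exists [::].
have [_ dx] := parP x x0; have [|p pth lp] := IH (par x); first by lia.
by exists (rcons p x); rewrite ?last_rcons // rcons_path pth lp parE x0 eqxx.
Qed.

Lemma containsI (T : lgraph n) s p : path (parent T.1) ord0 p ->
  infix s (pairmap (step T.2) ord0 p) -> contains T s.
Proof.
move=> pth inf; have sz : size p < n.+1.
  have up : uniq (ord0 :: p).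
    apply: (@sorted_uniq _ (fun x y => dist T.1 x < dist T.1 y)).
    - by move=> y x z; apply: ltn_trans.
    - by move=> x; rewrite ltnn.
    - by apply: sub_path pth => x y /andP[].
  exact: (size_uniq_ord up).
apply/existsP; exists (Ordinal sz); apply/existsP; exists (in_tuple p).
by rewrite /= pth.
Qed.

(** * Labels along the edges of an avoiding tree *)

Section Labels.

Variable T : lgraph n.
Hypothesis Ttree : is_tree T.1.
Hypothesis Tgnc : gnc_labelling T.2.
Hypothesis Tav : avoids T [:: [:: asc; asc]; [:: desc; desc]; [:: lev]].

Lemma label_ge1 x : 0 < T.2 x.
Proof.
case/and3P: Tgnc => /forallP/(_ ord0)/forallP/(_ x)/implyP mono /eqP l0 _.
by have := mono isT; rewrite l0.
Qed.

Lemma avoids_lev x y : parent T.1 x y -> T.2 x != T.2 y.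
Proof.
move=> xy; case/and4P: Tav => _ _ av _; apply: contra av => /eqP lxy.
have [p pth lp] := parent_path x Ttree.
apply: (@containsI _ _ (rcons p y)); first by rewrite rcons_path pth lp.
rewrite -cats1 pairmap_cat lp /=; apply/infixP.
exists (pairmap (step T.2) ord0 p), [::].
by rewrite /step lxy ltnn eqxx.
Qed.

Lemma avoids_double x y z : parent T.1 x y -> parent T.1 y z ->
  (T.2 x < T.2 y) != (T.2 y < T.2 z).
Proof.
move=> xy yz; apply/eqP => same.
have nxy := avoids_lev xy; have nyz := avoids_lev yz.
have [p pth lp] := parent_path x Ttree.
have pth2 : path (parent T.1) ord0 (p ++ [:: y; z]).
  by rewrite cat_path pth lp /= xy yz.
case/and4P: Tav => uu dd _ _.
have [lt|ge] := boolP (T.2 x < T.2 y); [case/negP: uu|case/negP: dd].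
all: apply: containsI pth2 _; rewrite pairmap_cat lp /=; apply/infixP.
all: exists (pairmap (step T.2) ord0 p), [::]; rewrite /step -same.
  by rewrite lt.
by rewrite (negbTE ge) (negbTE nxy) (negbTE nyz).
Qed.

(** Ascents and descents take turns along a path from the root, and the first step is an ascent
    because the root has the least label 1. *)
Lemma parent_step x y : parent T.1 x y -> (T.2 x < T.2 y) = ~~ odd (dist T.1 x).
Proof.
have [m] := ubnP (dist T.1 x); elim: m x y => // m IH x y.
rewrite ltnS => xm xy.
have [x0|x0] := eqVneq x ord0.
  have := avoids_lev xy; rewrite x0 dist_root; case/and3P: Tgnc => _ /eqP l0 _.
  have := label_ge1 y; rewrite -val_eqE /= l0; lia.
have [par parE [parP _]] := tree_parents Ttree.
have [_ dx] := parP x x0.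
have px : parent T.1 (par x) x by rewrite parE x0 eqxx.
have /negbTE := avoids_double px xy; rewrite (IH _ _ _ px); last by lia.
by rewrite dx /=; case: (odd _); case: (_ < _).
Qed.

(** The rule extends to upward steps because the depths of neighbours have opposite parity and their
    labels differ. *)
Lemma adj_label x y : adj T.1 x y -> (T.2 x < T.2 y) = ~~ odd (dist T.1 x).
Proof.
move=> xy; have [par parE [parP tot]] := tree_parents Ttree.
case/orP: (tot _ _ xy) => [/parent_step//|yx].
have := parent_step yx; have := avoids_lev yx.
case/andP: yx => yx lt; have [->|] := adj_dist Ttree yx; last by lia.
by rewrite /= negbK -val_eqE /=; lia.
Qed.

Lemma avoids_label_lt x y : adj T.1 x y -> x < y -> T.2 x < T.2 y.
Proof.
move=> xy lt; case/and3P: Tgnc => /forallP/(_ x)/forallP/(_ y)/implyP mono _ _.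
rewrite ltn_neqAle mono 1?ltnW // andbT.
have [par parE [parP tot]] := tree_parents Ttree.
by case/orP: (tot _ _ xy) => /avoids_lev //; rewrite eq_sym.
Qed.

(** Labels would increase along both edges, placing [y] at odd depth as the larger end of one and at
    even depth as the smaller end of the other. *)
Lemma avoids_alternating x y z : x < y -> y < z ->
  adj T.1 x y -> adj T.1 y z -> False.
Proof.
move=> lxy lyz xy yz.
have := avoids_label_lt xy lxy; have := avoids_label_lt yz lyz.
have := adj_label yz; rewrite adjC in xy; have := adj_label xy; lia.
Qed.

End Labels.

(** The flag [b] tells on which side of the current vertex all its neighbours lie. Alternation flips
    it at each step, so descents and ascents take turns. *)
Lemma alternating_word E (l : labelling n) b x p :
    (forall x y, adj E x y -> x < y -> l x < l y) ->
    (forall x y z, x < y -> y < z -> adj E x y -> adj E y z -> False) ->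
    simple_graph E -> path (adj E) x p ->
    (forall y, adj E x y -> (y < x) = b) ->
  forall i, i < size p ->
    nth lev (pairmap (step l) x p) i = if b (+) odd i then desc else asc.
Proof.
move=> llt alt sE; elim: p b x => //= y p IH b x /andP[xy pth] xb [|i] ip /=.
  rewrite addbF /step -(xb y xy); have := adj_neq sE xy.
  have yx : adj E y x by rewrite adjC.
  rewrite -val_eqE neq_ltn /= => /orP[lt|lt].
    by rewrite (llt _ _ xy lt) ltnNge ltnW.
  have ly := llt _ _ yx lt.
  by rewrite lt ltnNge (ltnW ly) /= -val_eqE /= gtn_eqF.
rewrite (IH (~~ b)) //; first by case: b {xb} => /=; case: odd.
move=> z yz; have := xb y xy; have := adj_neq sE xy; have := adj_neq sE yz.
have zy : adj E z y by rewrite adjC.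
have yx : adj E y x by rewrite adjC.
rewrite -!val_eqE /= => nyz nxy xyb.
have [lt1|lt1] := ltnP y x; have [lt2|lt2] := ltnP z y; try lia.
  by have := alt _ _ _ lt2 lt1 zy yx.
by have := @alt x y z; lia.
Qed.

Lemma avoids_of_alternating (T : lgraph n) :
    (forall x y, adj T.1 x y -> x < y -> T.2 x < T.2 y) ->
    (forall x y z, x < y -> y < z -> adj T.1 x y -> adj T.1 y z -> False) ->
    simple_graph T.1 ->
  avoids T [:: [:: asc; asc]; [:: desc; desc]; [:: lev]].
Proof.
move=> llt alt sE.
have nthw p i : path (parent T.1) ord0 p -> i < size p ->
    nth lev (pairmap (step T.2) ord0 p) i = if odd i then desc else asc.
  (* No point is smaller than the root, so the flag starts as [false]. *)
  move=> pth; apply: (@alternating_word _ _ false _ _ llt alt sE).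
    by apply: sub_path pth => x y /andP[].
  by move=> y _; rewrite ltn0.
apply/and4P; split=> //; apply/negP => /existsP[k] /existsP[p] /andP[pth].
all: move/infixP => [s1 [s2 e]].
all: have sz := congr1 size e; rewrite size_pairmap !size_cat /= in sz.
all: have lt1 : size s1 < size p by rewrite sz -addn1 leq_add2l.
all: have := nthw p (size s1) pth lt1.
1,2: have lt2 : (size s1).+1 < size p by rewrite sz -addn2 leq_add2l.
1,2: have := nthw p (size s1).+1 pth lt2.
all: rewrite e !nth_cat !ltnn !subnn ?(ltnNge _.+1) ?leqnSn /= ?subSnn /=.
all: by case: odd.
Qed.

End Trees.

(** * Alternating GNC-trees as binary trees *)

Section Bijection.

Variable n : nat.
Implicit Types (E : graph n) (x y z w : 'I_n.+1) (t : btree).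

Lemma set2_ord_inj x y z w : x < y -> z < w ->
  [set x; y] = [set z; w] -> x = z /\ y = w.
Proof.
move=> xy zw /setP e.
have := e x; have := e y; have := e z; have := e w; rewrite !inE !eqxx !orbT /=.
rewrite -!val_eqE /= => ? ? ? ?.
by split; apply: val_inj => /=; lia.
Qed.

Definition rises (l : labelling n) : pred nat :=
  fun i => l (inord i) < l (inord i.+1).

Lemma gnc_labelling_rises (l : labelling n) x :
  gnc_labelling l -> l x = (count (rises l) (iota 0 x)).+1 :> nat.
Proof.
case/and3P=> mono /eqP l0 /existsP[m /eqP/setP lm].
have monoP y z : y <= z -> l y <= l z.
  by move: mono => /forallP/(_ y)/forallP/(_ z)/implyP.
have inordE i : i <= n -> (inord i : 'I_n.+1) = i :> nat.
  by move=> ?; rewrite inordK.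
(* A jump by two or more would skip a label: points before the gap are too low and points after it
   too high, while the label set has no holes. *)
have step_le i : i < n -> l (inord i.+1) <= (l (inord i)).+1.
  move=> ni; rewrite leqNgt; apply/negP => lt.
  have := lm (l (inord i.+1)); rewrite inE imset_f // => /esym/andP[_ lem].
  have ub := ltn_ord (l (inord i.+1)).
  have := lm (inord (l (inord i)).+1); rewrite inE inordK; last by lia.
  rewrite (leq_trans (ltnW lt) lem) /= => /imsetP[z _ /(congr1 val)].
  rewrite /= inordK; last by lia.
  have [zi|zi] := leqP z i.
    by have := @monoP z (inord i); rewrite inordE; [lia|lia].
  by have := @monoP (inord i.+1) z; rewrite inordE; [lia|lia].
have lE i : i <= n -> l (inord i) = (count (rises l) (iota 0 i)).+1 :> nat.
  elim: i => [_|i IH ni].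
    by rewrite -l0; congr (nat_of_ord (l _)); apply: val_inj; rewrite /= inordE.
  rewrite -[in iota 0 i.+1]addn1 iotaD count_cat /= addn0 add0n -addSn.
  rewrite -IH; last by lia.
  have := step_le i ni; have := @monoP (inord i) (inord i.+1).
  by rewrite !inordE /rises; lia.
by rewrite -{1}(inord_val x) lE // -ltnS.
Qed.

Lemma labelling_rises (l : labelling n) (g : pred nat) :
  (forall x, l x = (count g (iota 0 x)).+1 :> nat) -> gnc_labelling l.
Proof.
move=> lE; have cmono i j : i <= j -> count g (iota 0 i) <= count g (iota 0 j).
  by move=> ij; rewrite -(subnKC ij) iotaD count_cat leq_addr.
apply/and3P; split.
- apply/forallP=> x; apply/forallP=> y; apply/implyP=> xy.
  by rewrite !lE ltnS cmono.
- by rewrite lE.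
- apply/existsP; exists (l ord_max); apply/eqP/setP=> k; rewrite inE.
  apply/imsetP/andP=> [[x _ ->]|[k0 km]].
    by rewrite !lE ltnS; split=> //; rewrite ltnS cmono //= -ltnS.
  have [i /andP[ik iN]] : exists i, (k <= (count g (iota 0 i)).+1) && (i <= n).
    by exists n; rewrite leqnn andbT; rewrite lE in km.
  have ex : exists i, k <= (count g (iota 0 i)).+1 by exists i.
  (* The first point whose label reaches [k] has label exactly [k], since labels grow by at most one
     per gap. *)
  case: (ex_minnP ex) => j jk jmin.
  have jn : j < n.+1 by rewrite ltnS (leq_trans (jmin i ik)).
  exists (Ordinal jn) => //; apply: val_inj; rewrite /= lE /=.
  case: j jk jmin {jn} => [|j] jk jmin; first by rewrite /= in jk *; lia.
  have := jmin j; move: jk.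
  rewrite -[in iota 0 j.+1]addn1 iotaD count_cat /= addn0 add0n.
  by case: (g j) => /=; lia.
Qed.

Definition graph_of t : graph n :=
  [set e | [exists x : 'I_n.+1, exists y : 'I_n.+1,
              ((x : nat, y : nat) \in edges t 0) && (e == [set x; y])]].

Definition label_of t : labelling n :=
  [ffun x : 'I_n.+1 => inord (count id (take x (marks t))).+1].

Definition lgraph_of t : lgraph n := (graph_of t, label_of t).

Lemma adj_graph_of t x y : x < y ->
  adj (graph_of t) x y = ((x : nat, y : nat) \in edges t 0).
Proof.
move=> xy; rewrite /adj inE.
apply/existsP/idP => [[z /existsP[w]]|xyE]; last first.
  by exists x; apply/existsP; exists y; rewrite xyE /=.
case/andP=> zw /eqP /set2_ord_inj[//||-> ->//].
by have := edges_bound zw; lia.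
Qed.

Lemma simple_graph_of t : simple_graph (graph_of t).
Proof.
apply/forall_inP => e; rewrite inE => /existsP[x /existsP[y /andP[xy /eqP ->]]].
by have := edges_bound xy; rewrite cards2 -val_eqE /=; lia.
Qed.

Lemma adj_lt_eq E E' : simple_graph E -> simple_graph E' ->
  (forall x y, x < y -> adj E x y = adj E' x y) -> E = E'.
Proof.
move=> sE sE' eqE; apply/setP.
suff H (F F' : graph n) : simple_graph F ->
    (forall x y, x < y -> adj F x y = adj F' x y) -> {subset F <= F'}.
  by move=> e; apply/idP/idP; apply: H => // x y xy; rewrite eqE.
move=> /forall_inP sF eqF e eF; have /cards2P[x [y [xy ee]]] := sF e eF.
rewrite ee in eF *; move: xy; rewrite -val_eqE neq_ltn /= => /orP[lt|lt].
  by have := eqF _ _ lt; rewrite /adj eF.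
by rewrite setUC in eF *; have := eqF _ _ lt; rewrite /adj eF.
Qed.

Definition nat_edge E : rel nat :=
  fun i j => [&& i < j, j <= n & adj E (inord i) (inord j)].

Lemma nat_edge_graph_of t i j : nodes t = n ->
  nat_edge (graph_of t) i j = ((i, j) \in edges t 0).
Proof.
move=> nt; rewrite /nat_edge; have [ij|ij] := ltnP i j; last first.
  by apply/esym/negP => /edges_bound; lia.
have [jn|jn] := leqP j n; last by apply/esym/negP => /edges_bound; lia.
by rewrite /= adj_graph_of !inordK //; lia.
Qed.

Lemma connected_interval E : simple_graph E ->
  connected E <-> interval_connected (nat_edge E) 0 n.
Proof.
move=> sE; split=> [cE S Sinv i /andP[_ ni]|cE].
  pose a := [pred x : 'I_n.+1 | S x].
  have clos : closed (adj E) a.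
    move=> x y xy; rewrite !inE; have := adj_neq sE xy.
    rewrite -val_eqE neq_ltn => /orP[] lt; [|symmetry]; apply: Sinv => //.
    + by rewrite -ltnS.
    + by rewrite /nat_edge lt !inord_val xy -ltnS ltn_ord.
    + by rewrite -ltnS.
    + by rewrite /nat_edge lt !inord_val adjC xy -ltnS ltn_ord.
  move: cE => /forallP/(_ (inord i))/forallP/(_ ord0)/(closed_connect clos).
  by rewrite !inE inordK.
have conn0 x : connect (adj E) ord0 x.
  have := cE (fun i => connect (adj E) ord0 (inord i)) _ x.
  rewrite inord_val => -> //.
  - have -> : inord 0 = ord0 :> 'I_n.+1 by apply: val_inj; rewrite /= inordK.
    exact: connect0.
  - move=> i j _ _ /and3P[_ _ ij]; apply/idP/idP => h.
      exact: connect_trans h (connect1 ij).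
    by apply: connect_trans h (connect1 _); rewrite adjC.
  - by rewrite /= -ltnS.
apply/forallP=> x; apply/forallP=> y; apply: connect_trans (conn0 y).
by rewrite sym_connect_sym // => u v; rewrite adjC.
Qed.

(** By alternation, the other cycle edges at the ends of a shortest edge [xy], [x < y], go to the
    right from [x] and to the left from [y]. Neither is shorter than [xy], so each passes beyond the
    opposite end. *)
Lemma noncrossing_alternating_acyclic E : simple_graph E -> noncrossing E ->
  (forall x y z, x < y -> y < z -> adj E x y -> adj E y z -> False) ->
  acyclic E.
Proof.
move=> sE ncE alt.
have nc x y z w : x < z -> z < y -> y < w -> adj E x y -> adj E z w -> False.
  move=> xz zy yw xy zw; move: ncE => /forallP/(_ x)/forallP/(_ y).
  by move=> /forallP/(_ z)/forallP/(_ w); rewrite xz zy yw xy zw.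
apply/forallP=> k; apply/forallP=> c; apply/implyP=> k2; apply/negP.
case/andP=> cyc uc; have sc := size_tuple c.
set s : seq 'I_n.+1 := c in cyc uc sc.
have s2 : 2 < size s by rewrite sc.
(* The successor and the predecessor of [x] on the cycle are distinct, since the length exceeds 2;
   one of them is not [y]. *)
have other x y : x \in s -> exists z, [&& z \in s, z != y & adj E x z].
  move=> xs; have [i q def_s] := rot_to xs.
  have [b [q' def_q]] : exists b q', q = b :: q'.
    case: (q) def_s (size_rot i s) => [|b q'] -> /= e; last by exists b, q'.
    by rewrite -e in s2.
  have uq : uniq (x :: q) by rewrite -def_s rot_uniq.
  have cq : cycle (adj E) (x :: q) by rewrite -def_s rot_cycle.
  have mem_s z : z \in x :: q -> z \in s by rewrite -def_s mem_rot.
  rewrite {}def_q in uq cq mem_s def_s.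
  have xb : adj E x b by case/andP: cq.
  have xl : adj E x (last b q').
    by move: cq => /= /andP[_]; rewrite rcons_path adjC => /andP[].
  have bl : b != last b q'.
    have : size s = (size q').+2 by rewrite -(size_rot i) def_s.
    case: q' {xl cq mem_s def_s} uq => [|b' q'].
      by move=> _ e; rewrite e in s2.
    by move=> /= /and3P[_ bq _] _; apply: contraNneq bq => ->; apply: mem_last.
  have [by_|by_] := eqVneq b y; last first.
    by exists b; rewrite by_ xb mem_s // !inE eqxx orbT.
  exists (last b q'); rewrite xl -by_ eq_sym bl mem_s // inE.
  by rewrite mem_last orbT.
pose P d := [exists x, exists y,
  [&& x \in s, y \in s, adj E x y, x < y & (y - x)%N == d]].
have exP : exists d, P d.
  have [x0 x0s] : exists x, x \in s.
    by case: (s) s2 => [|x ? _] //; exists x; rewrite mem_head.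
  have [x1 /and3P[x1s _ x01]] := other x0 x0 x0s.
  have := adj_neq sE x01; rewrite -val_eqE neq_ltn => /orP[] lt.
    exists (x1 - x0); apply/existsP; exists x0; apply/existsP; exists x1.
    by rewrite x0s x1s x01 lt /=.
  exists (x0 - x1); apply/existsP; exists x1; apply/existsP; exists x0.
  by rewrite x0s x1s adjC x01 lt /=.
(* The other edges of the cycle at the ends of its shortest edge [xy] cross. *)
case: (ex_minnP exP) => d /existsP[x /existsP[y]].
move=> /and5P[xs ys xy lt /eqP dxy] dmin.
have short u v : u \in s -> v \in s -> adj E u v -> u < v -> y - x <= v - u.
  move=> us vs uv ltuv; rewrite dxy; apply: dmin.
  by apply/existsP; exists u; apply/existsP; exists v; rewrite us vs uv ltuv /=.
have [z /and3P[zs zy xz]] := other x y xs.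
have [w /and3P[ws wx yw]] := other y x ys.
have zx := adj_neq sE xz; have wy := adj_neq sE yw.
move: zy wx zx wy; rewrite -!val_eqE /= => zy wx zx wy.
have zx' : x < z.
  rewrite ltnNge leq_eqVlt negb_or eq_sym zx /=; apply/negP => lt'.
  by apply: (alt z x y) => //; rewrite adjC.
have wy' : w < y.
  rewrite ltnNge leq_eqVlt negb_or wy /=; apply/negP => lt'.
  by apply: (alt x y w).
have wyE : adj E w y by rewrite adjC.
have h1 := short x z xs zs xz zx'; have h2 := short w y ws ys wyE wy'.
by apply: (nc w y x z) => //; lia.
Qed.

Lemma label_of_count t x : nodes t = n ->
  label_of t x = (count (nth false (marks t)) (iota 0 x)).+1 :> nat.
Proof.
move=> nt; have xn : x <= n by rewrite -ltnS.
rewrite ffunE -[count id _](_ : count (nth false (marks t)) (iota 0 x) = _).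
  by rewrite inordK // !ltnS (leq_trans (count_size _ _)) // size_iota.
by rewrite -(count_map _ id) map_nth_iota0 // size_marks nt.
Qed.

Lemma rises_label_of t i : nodes t = n -> i < n ->
  rises (label_of t) i = nth false (marks t) i.
Proof.
move=> nt ni; rewrite /rises !label_of_count // !inordK; [|lia..].
rewrite -[in iota 0 i.+1]addn1 iotaD count_cat /= addn0 add0n.
by case: (nth _ _ i) => /=; lia.
Qed.

Lemma lgraph_of_alternating t : valid t -> nodes t = n ->
  lgraph_of t \in alternating_gnc n.
Proof.
move=> vt nt; have sE := simple_graph_of t.
have nc : noncrossing (graph_of t).
  apply/forallP=> a; apply/forallP=> b; apply/forallP=> c; apply/forallP=> d.
  apply/implyP=> /and3P[ac cb bd]; apply/negP.
  rewrite (adj_graph_of _ (ltn_trans ac cb)) (adj_graph_of _ (ltn_trans cb bd)).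
  case/andP=> h h'.
  exact: edges_noncrossing h h' ac cb bd.
have alt x y z : x < y -> y < z ->
    adj (graph_of t) x y -> adj (graph_of t) y z -> False.
  by move=> xy yz; rewrite !adj_graph_of //; apply: edges_alternating.
have llt x y : adj (graph_of t) x y -> x < y -> label_of t x < label_of t y.
  move=> xyE xy; rewrite !label_of_count // ltnS.
  (* A marked gap spanned by the edge makes the count of marks strictly larger at [y]. *)
  rewrite adj_graph_of // in xyE; have [i /andP[xi iy] hi] := edges_mark vt xyE.
  rewrite -(subnKC (ltnW xy)) iotaD count_cat -addn1 leq_add2l.
  rewrite -has_count; apply/hasP; exists i; first by rewrite mem_iota; lia.
  by rewrite subn0 in hi.
rewrite inE; apply/andP; split; last exact: avoids_of_alternating.
apply/and3P; split=> //.
  apply/and3P; split=> //; last exact: noncrossing_alternating_acyclic.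
  apply/(connected_interval sE) => S Sinv x xn.
  apply: (@edges_connected t 0 S) => [u v u0 vn uv|]; last by rewrite nt.
  by apply: Sinv; rewrite ?nat_edge_graph_of //; rewrite nt in vn.
by apply: labelling_rises => x; apply: label_of_count.
Qed.

Lemma lgraph_of_inj t t' : nodes t = n -> nodes t' = n ->
  lgraph_of t = lgraph_of t' -> t = t'.
Proof.
move=> nt nt' [eG eL]; apply: (@edges_marks_inj _ _ 0); first by rewrite nt.
  by move=> [i j]; rewrite -!nat_edge_graph_of // eG.
apply: (@eq_from_nth _ false) => [|i]; rewrite !size_marks ?nt // => ni.
by rewrite -!rises_label_of // eL.
Qed.

(** * Recovering the binary tree and counting ascents *)

Variable T : lgraph n.
Hypothesis Talt : T \in alternating_gnc n.

Lemma alternating_gncP :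
  [/\ is_tree T.1, noncrossing T.1, gnc_labelling T.2,
      forall x y, adj T.1 x y -> x < y -> T.2 x < T.2 y &
      forall x y z, x < y -> y < z -> adj T.1 x y -> adj T.1 y z -> False].
Proof.
move: Talt; rewrite inE => /andP[/and3P[tr nc lab] av].
split=> //; first exact: avoids_label_lt.
exact: (avoids_alternating tr lab av).
Qed.

(** [btree_of_rel] is applied with the rises of the labelling as marks: labels increase along edges,
    so an edge between consecutive points forces a rise. *)
Lemma lgraph_of_surj : exists t, [/\ valid t, nodes t = n & lgraph_of t = T].
Proof.
have [tr nc lab llt alt] := alternating_gncP.
have /and3P[sE cE _] := tr.
have inordE i : i <= n -> (inord i : 'I_n.+1) = i :> nat.
  by move=> ?; rewrite inordK.
have [|||||t [nt vt mt et]] :=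
  @btree_of_rel (nat_edge T.1) _ _ _ (rises T.2) _ n 0.
- by move=> x y /and3P[].
- move=> x y x' y' /and3P[_ _ xy] /and3P[_ yn' xy'] h1 h2 h3.
  move: nc => /forallP/(_ (inord x))/forallP/(_ (inord y)).
  move=> /forallP/(_ (inord x'))/forallP/(_ (inord y')).
  by rewrite xy xy' !inordE ?h1 ?h2 ?h3 //; lia.
- move=> x y z /and3P[h1 _ xy] /and3P[h2 zn yz].
  by apply: (alt _ _ _ _ _ xy yz); rewrite !inordE; lia.
- by move=> i /and3P[_ ni ii]; apply: llt => //; rewrite !inordE; lia.
- by apply/connected_interval.
exists t; split=> //; rewrite [RHS]surjective_pairing; congr pair.
  apply: adj_lt_eq => // [|x y xy]; first exact: simple_graph_of.
  rewrite adj_graph_of // et /nat_edge /= !inord_val xy /=.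
  by have := ltn_ord y; rewrite ltnS => ->.
apply/ffunP=> x; apply: val_inj; rewrite /= label_of_count //.
rewrite (gnc_labelling_rises x lab); congr _.+1; apply: eq_in_count => i.
rewrite mem_iota /= add0n => ix; have := ltn_ord x => xn.
by rewrite mt (nth_map 0) ?size_iota ?nth_iota //; lia.
Qed.

(* Every vertex other than the root has one parent, and the edge from it is an
   ascent iff the vertex has a smaller neighbour. *)
Lemma ascents_right_ends :
  ascents T =
  #|[set y : 'I_n.+1 | [exists x : 'I_n.+1, (x < y) && adj T.1 x y]]|.
Proof.
have [tr nc lab llt alt] := alternating_gncP.
have [par parE [parP _]] := tree_parents tr.
have /and3P[sE _ _] := tr.
rewrite -(card_imset _ (_ : injective (fun y => (par y, y)))); last first.
  by move=> ? ? [].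
congr #|pred_of_set _|; apply/setP=> -[x y]; rewrite inE /=.
have stepE u v : (step T.2 u v == asc) = (T.2 u < T.2 v).
  by apply/eqP/idP; rewrite /step; case: ifP => // _; case: ifP.
have mono u v : adj T.1 u v -> T.2 u < T.2 v -> u < v.
  move=> uv lt; rewrite ltnNge leq_eqVlt; apply/negP => /orP[/eqP e|lt'].
    by have := adj_neq sE uv; rewrite -val_eqE /= e eqxx.
  by rewrite adjC in uv; have := llt _ _ uv lt'; lia.
apply/andP/imsetP => [[xy]|[y']].
  have xyE : adj T.1 x y by case/andP: xy.
  rewrite stepE => /(mono _ _ xyE) lt; exists y.
    by rewrite inE; apply/existsP; exists x; rewrite lt.
  by move: xy; rewrite parE => /andP[_ /eqP ->].
rewrite inE => /existsP[w /andP[wy wyE]] [-> ->].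
have y0 : y' != ord0 by rewrite -val_eqE /=; lia.
have [pE _] := parP y' y0.
rewrite parE y0 eqxx stepE; split=> //; apply: llt => //.
(* A parent to the right of [y'] would be a larger neighbour besides the smaller neighbour [w]. *)
have := adj_neq sE pE; rewrite -val_eqE neq_ltn => /orP[//|lt].
by rewrite adjC in pE; have := alt _ _ _ wy lt wyE pE.
Qed.

End Bijection.

Lemma ascents_lgraph_of n t : valid t -> nodes t = n ->
  ascents (lgraph_of n t) = highs t.
Proof.
move=> vt nt; rewrite ascents_right_ends; last exact: lgraph_of_alternating.
rewrite -(count_highs t 0) nt cardE size_filter -val_enum_ord !count_map.
apply: eq_count => y; rewrite /= inE.
apply/existsP/hasP => [[x /andP[xy]]|[[x y'] xyE /= /eqP e]].
  by rewrite adj_graph_of // => xyE; exists (x : nat, y : nat).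
rewrite e in xyE; have /and3P[_ xy _] := edges_bound xyE.
have xn : x < n.+1 by apply: ltn_trans xy _.
by exists (Ordinal xn); rewrite /= xy adj_graph_of.
Qed.

Lemma alternating_gnc_enum n :
  perm_eq (enum (alternating_gnc n)) [seq lgraph_of n t | t <- btrees n n].
Proof.
have memE t : t \in btrees n n -> valid t /\ nodes t = n.
  by rewrite mem_btrees // => /andP[vt /eqP].
apply: uniq_perm; first exact: enum_uniq.
  rewrite map_inj_in_uniq ?btrees_uniq // => t t' /memE[_ nt] /memE[_ nt'].
  exact: lgraph_of_inj.
move=> T; rewrite mem_enum.
apply/idP/mapP => [/lgraph_of_surj[t [vt nt <-]]|[t]].
  by exists t; rewrite // mem_btrees // vt nt eqxx.
by move=> /memE[vt nt] ->; apply: lgraph_of_alternating.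
Qed.

(** * The generating function *)

Import GRing.Theory Num.Theory.
Local Open Scope ring_scope.

(** * The Catalan convolution *)

Lemma catalan0 : catalan 0 = 1.
Proof. by rewrite /catalan bin0 invr1 mulr1. Qed.

Lemma central_binS i : ((i.+1)%:R * 'C(i.+1.*2, i.+1)%:R : rat) =
  2 * (2 * i%:R + 1) * 'C(i.*2, i)%:R.
Proof.
have e1 := mul_bin_diag i.+1.*2 i; have e2 := mul_bin_diag i.*2.+1 i.
have e3 : 'C(i.*2.+1, i.+1) = 'C(i.*2.+1, i).
  by rewrite -bin_sub; [congr 'C(_, _)|]; lia.
rewrite doubleS /= in e1; rewrite e3 /= in e2; rewrite -natrM doubleS -e1.
apply: (@mulfI _ (i.+1%:R : rat)); first by rewrite pnatr_eq0.
by rewrite -[LHS]natrM mulnCA -e2 !natrM -!muln2 -!natr1 natrM -!natr1; ring.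
Qed.

(* Its differences in [j] are the terms of the Catalan convolution. *)
Definition gosper (N j : nat) : rat :=
  'C(j.*2, j)%:R * 'C((N - j).*2, N - j)%:R * (2 * j%:R - N%:R)
  / (2 * N%:R * (N%:R + 1)).

Lemma gosperE n i : (i <= n)%N ->
  gosper n.+1 i.+1 - gosper n.+1 i = catalan i * catalan (n - i).
Proof.
move=> le_in; have [j ->] : exists j, n = (i + j)%N by exists (n - i)%N; lia.
rewrite /gosper /catalan subSS addKn -addnS addKn.
have ci := central_binS i; have cj := central_binS j.
have nz k : (k.+1%:R : rat) != 0 by rewrite pnatr_eq0.
(* The ratios of successive central binomials turn the claim into an identity of rational functions
   in [i] and [j]. *)
have -> : ('C(i.+1.*2, i.+1)%:R : rat) =
    2 * (2 * i%:R + 1) * 'C(i.*2, i)%:R / i.+1%:R.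
  by apply: (mulfI (nz i)); rewrite ci [RHS]mulrC divfK.
have -> : ('C(j.+1.*2, j.+1)%:R : rat) =
    2 * (2 * j%:R + 1) * 'C(j.*2, j)%:R / j.+1%:R.
  by apply: (mulfI (nz j)); rewrite cj [RHS]mulrC divfK.
have n1 := nz i; have n2 := nz j.
have n3 := nz (i + j)%N; have n4 := nz (i + j).+1.
rewrite -!natr1 natrD in n1 n2 n3 n4 *.
rewrite addnS -!natr1 natrD.
by field; rewrite n1 n2 n3 n4.
Qed.

(** The convolution telescopes; the values of [gosper n.+1] at [n.+1] and at 0 are plus and minus
    half of [catalan n.+1]. *)
Lemma catalanS n :
  catalan n.+1 = \sum_(i < n.+1) catalan i * catalan (n - i).
Proof.
rewrite (eq_bigr (fun i : 'I_n.+1 => gosper n.+1 i.+1 - gosper n.+1 i)); last first.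
  by move=> i _; rewrite gosperE // -ltnS.
rewrite -(big_mkord xpredT (fun i => gosper n.+1 i.+1 - gosper n.+1 i)).
rewrite telescope_sumr // /gosper /catalan subnn subn0 double0 bin0.
have n1 : (n.+1%:R : rat) != 0 by rewrite pnatr_eq0.
have n2 : (n.+2%:R : rat) != 0 by rewrite pnatr_eq0.
rewrite -[n.+2%:R]natr1 in n2 *.
by field; rewrite !nat1r n1 n2.
Qed.

(** * Power series truncated modulo a power of the variable *)

Section PowerSeries.

Variable A : comNzRingType.

(** Congruence modulo ['X^N], so that polynomials can stand for power series; the explicit cofactor
    survives composition. *)
Definition eqX N (p q : {poly A}) := exists r, p = q + r * 'X^N.

Lemma eqXP N (p q : {poly A}) :
  (forall i, (i < N)%N -> p`_i = q`_i) <-> eqX N p q.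
Proof.
split=> [e|[r ->] i iN]; last first.
  by rewrite coefD coefMXn iN addr0.
exists (drop_poly N (p - q)).
have := poly_take_drop N (p - q); rewrite (_ : take_poly N (p - q) = 0) ?add0r.
  by move=> ->; rewrite addrC subrK.
apply/polyP=> i; rewrite coef_take_poly coef0 coefB.
by case: ifP => // /e ->; rewrite subrr.
Qed.

Lemma coef_exp_linear (a : A) n j :
  ((1 + a *: 'X) ^+ n)`_j = a ^+ j *+ 'C(n, j).
Proof.
elim: n j => [|n IH] j; first by rewrite expr0 coef1 bin0n; case: j.
rewrite exprS mulrDl mul1r -scalerAl coefD coefZ coefXM IH; case: j => [|j].
  by rewrite !bin0 mulr0 addr0.
by rewrite IH binS mulrnDr exprS mulrnAr.
Qed.

(** The truncation of 1/(1 - wX). *)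
Definition geom (w : A) N : {poly A} := \poly_(k < N) w ^+ k.

Lemma geom_inv w N : eqX N ((1 - w *: 'X) * geom w N) 1.
Proof.
apply/eqXP=> i iN; rewrite mulrBl mul1r -scalerAl coefB coefZ coefXM !coef_poly.
rewrite iN coef1; case: i iN => [|i] iN; first by rewrite expr0 mulr0 subr0.
by rewrite (ltnW iN) -exprS subrr.
Qed.

Lemma hockey_stick m k : (\sum_(l < k.+1) 'C(m + l, l) = 'C((m + k).+1, k))%N.
Proof.
elim: k => [|k IH]; first by rewrite big_ord_recr big_ord0 /= !bin0.
by rewrite big_ord_recr IH /= addnS binS addnC.
Qed.

Lemma coef_geom_exp w N m k : (k < N)%N ->
  (geom w N ^+ m.+1)`_k = w ^+ k *+ 'C(m + k, k).
Proof.
elim: m k => [|m IH] k kN; first by rewrite expr1 coef_poly kN add0n binn.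
rewrite exprSr coefM addSn -hockey_stick -sumrMnr.
apply: eq_bigr => -[l lk] _ /=.
rewrite IH ?coef_poly; last by lia.
rewrite (_ : (k - l < N)%N); last by lia.
by rewrite mulrnAl -exprD subnKC // -ltnS.
Qed.

Variables (c : nat -> A) (t : A).
Hypothesis c0 : c 0 = 1.
Hypothesis cS : forall n, c n.+1 = \sum_(i < n.+1) c i * c (n - i)%N.

Lemma catalan_series N :
  eqX N (\poly_(i < N) c i) (1 + 'X * (\poly_(i < N) c i) ^+ 2).
Proof.
apply/eqXP=> i iN; rewrite coefD coefXM coef_poly iN coef1.
case: i iN => [|i] iN; first by rewrite c0 addr0.
rewrite /= add0r cS expr2 coefM; apply: eq_bigr => -[j ji] _ /=.
by rewrite !coef_poly !ifT //; lia.
Qed.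

(** With this [w], [geom w N] truncates the series g = 1/(1 + 2x(1 - t)) of the closed form. *)
Let w := - (2 * (1 - t)).
Let u : {poly A} := 1 + (- t) *: 'X.

(** In the expansion of u g C(2xug^2), this takes the i-th Catalan term, the coefficient of x^j in
    u^(i+1) and that of x^k in g^(2i+1). *)
Definition tree_term i j k : A :=
  c i * 2 ^+ i * ((- t) ^+ j *+ 'C(i.+1, j)) * (w ^+ k *+ 'C(i.*2 + k, k)).

Definition tree_series N : {poly A} :=
  \sum_(i < N) (c i * 2 ^+ i) *: ('X^i * (u ^+ i.+1 * geom w N ^+ i.*2.+1)).

Definition tree_coef n : A :=
  \sum_(i < n.+1) \sum_(j < (n - i).+1) tree_term i j (n - i - j).

Lemma coef_tree_series N n : (n < N)%N -> (tree_series N)`_n = tree_coef n.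
Proof.
move=> nN; rewrite coef_sum (bigID (fun i : 'I_N => (i < n.+1)%N)) /=.
rewrite [X in _ + X]big1 ?addr0; last first.
  move=> i ni; rewrite coefZ coefXnM ifT ?mulr0 //; lia.
rewrite (big_ord_narrow nN) /=; apply: eq_bigr => -[i ni] _ /=.
rewrite coefZ coefXnM ifF; last by lia.
rewrite coefM mulr_sumr; apply: eq_bigr => -[j nj] _ /=.
rewrite coef_exp_linear coef_geom_exp; last by lia.
by rewrite /tree_term mulrA.
Qed.

Lemma tree_seriesE N :
  tree_series N = u * geom w N *
    ((\poly_(i < N) c i) \Po ('X * (2 * u * geom w N ^+ 2))).
Proof.
rewrite poly_def rmorph_sum mulr_sumr; apply: eq_bigr => i _.
rewrite /= comp_polyZ comp_Xn_poly -scalerAr -scalerA; congr (_ *: _).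
rewrite -mul_polyC rmorphXn rmorph_nat /= exprMn [(_ * _ ^+ 2) ^+ i]exprMn.
rewrite [(2 * u) ^+ i]exprMn -exprM mul2n !exprS.
set a := 2 ^+ i; set b := u ^+ i; set d := _ ^+ i.*2; set e := 'X^i; ring.
Qed.

(** With y = 2xug^2 and C = 1 + yC^2, the series F = ugC satisfies F/g = uC = u + uyC^2 = u +
    2xF^2. *)
Lemma tree_series_eq N :
  eqX N ((1 - w *: 'X) * tree_series N) (u + 2 * 'X * tree_series N ^+ 2).
Proof.
rewrite tree_seriesE.
have [g eg] := geom_inv w N; have [r er] := catalan_series N.
set G := geom w N in eg *; set y := 'X * _.
set K := _ \Po y.
have eK : K = 1 + y * K ^+ 2 + (r \Po y) * y ^+ N.
  rewrite {1}/K er !(comp_polyD, comp_polyM).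
  by rewrite rmorphXn /= !comp_polyX comp_polyC.
have -> : (1 - w *: 'X) * (u * G * K) = ((1 - w *: 'X) * G) * u * K by ring.
(* The cofactor collects the errors of both truncations; [y] is a multiple of ['X], so [y ^+ N] is
   one of ['X^N]. *)
rewrite eg; exists (u * (r \Po y) * (2 * u * G ^+ 2) ^+ N + g * u * K).
rewrite mulrDl mul1r mulrDl {1}eK /y exprMn; ring.
Qed.

Lemma tree_coef0 : tree_coef 0 = 1.
Proof.
rewrite /tree_coef !big_ord_recr !big_ord0 /= /tree_term c0 !bin0 !expr0.
by rewrite !add0r !mulr1.
Qed.

(** This is the recursion of [btrees]: an empty right subtree weighs [t], and the mark of the root
    has two values unless the root is childless. *)
Lemma tree_coefS n : tree_coef n.+1 =
  (\sum_(k < n.+1)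
     tree_coef k * (if (n - k)%N == 0%N then t else tree_coef (n - k)))
  *+ (if n == 0%N then 1 else 2).
Proof.
have := tree_series_eq n.+2 => /eqXP /(_ n.+1 (ltnSn _)).
rewrite mulrBl mul1r -scalerAl coefB coefZ coefXM /= !coef_tree_series //.
rewrite -mulrA coefD [in RHS]mulr_natl coefMn coefXM /= expr2 coefM.
rewrite coefD coef1 coefZ coefX /= add0r.
under eq_bigr => k _.
  rewrite !coef_tree_series; last 2 first.
  - by have := ltn_ord k; lia.
  - by have := ltn_ord k; lia.
  over.
(* The last summand, where F_0 = 1, combines with the term in [w] to 2tF_n. *)
rewrite big_ord_recr /= subnn tree_coef0 mulr1 => e.
rewrite big_ord_recr /= subnn eqxx.
rewrite (eq_bigr (fun k : 'I_n => tree_coef k * tree_coef (n - k))); last first.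
  by move=> k _; rewrite ifF //; have := ltn_ord k; lia.
move/eqP: e; rewrite subr_eq => /eqP ->.
(* For [n = 0] the coefficient -t of [u] reduces 2t to t. *)
case: n => [|n] /=.
  by rewrite big_ord0 !add0r mulr1 tree_coef0 /w mulr1n; ring.
by rewrite mulr0 add0r /w; ring.
Qed.

End PowerSeries.

Section Weights.

Variables (A : comNzRingType) (c : nat -> A) (t : A).
Hypothesis c0 : c 0 = 1.
Hypothesis cS : forall n, c n.+1 = \sum_(i < n.+1) c i * c (n - i)%N.

Lemma sum_btrees m n : (n <= m)%N ->
  \sum_(b <- btrees m n) t ^+ highs b = tree_coef c t n.
Proof.
elim: m n => [|m IH] [|n] // nm; try by rewrite /= big_seq1 tree_coef0.
(* The share of a right subtree in [highs]: an empty one still counts the end of the edge above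
   it. *)
pose right r := if r is Leaf then 1%N else highs r.
have sum_right j : (j <= m)%N -> \sum_(b <- btrees m j) t ^+ right b =
    if j == 0%N then t else tree_coef c t j.
  move=> jm; have [->|j0] := eqVneq j 0%N.
    by case: (m) => [|?]; rewrite /= big_seq1.
  rewrite -IH // big_seq [RHS]big_seq; apply: eq_bigr => b.
  rewrite mem_btrees // => /andP[_].
  by case: b => //= /eqP /esym /eqP; rewrite (negbTE j0).
rewrite tree_coefS // big_allpairs_dep /= /splits big_flatten big_map.
rewrite -[iota 0 n.+1]/(index_iota 0 n.+1) big_mkord -sumrMnl.
apply: eq_bigr => k _.
have kn := ltn_ord k.
rewrite big_allpairs_dep /= -IH; last by lia.
rewrite -sum_right; last by lia.
rewrite mulr_suml -sumrMnl; apply: eq_bigr => l _.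
rewrite mulr_sumr -sumrMnl; apply: eq_bigr => r _.
rewrite -exprD -/(right r).
by case: ifP => _; rewrite !big_cons big_nil /= addr0.
Qed.

End Weights.

(** * Reading off the two formulas *)

Lemma sum_diag (A : nmodType) (F : nat -> nat -> A) n i : (i <= n)%N ->
  \sum_(0 <= j < n.+1) \sum_(0 <= k < n.+1 | (i + j + k == n)%N) F j k =
  \sum_(j < (n - i).+1) F j (n - i - j)%N.
Proof.
move=> le_in; rewrite (@big_cat_nat _ _ _ (n - i).+1) //=; last by lia.
rewrite [X in _ + X]big1_seq ?addr0; last first.
  move=> j; rewrite mem_index_iota => /andP[_ ij].
  by rewrite big1_seq // => k /andP[/eqP ?]; lia.
rewrite big_mkord; apply: eq_bigr => -[j ij] _ /=.
have kn : (n - i - j < n.+1)%N by lia.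
rewrite big_mkord (big_pred1 (Ordinal kn)) // => k.
by rewrite -[RHS]/(_ == _) -val_eqE /=; lia.
Qed.

Definition ascent_poly n : {poly rat} :=
  \sum_(T in alternating_gnc n) 'X ^+ ascents T.

(** The Catalan numbers become constant polynomials so that [t] can be the indeterminate; the
    enumeration carries ascents over to [highs]. *)
Lemma ascent_polyE n : ascent_poly n = tree_coef (fun i => (catalan i)%:P) 'X n.
Proof.
rewrite -(sum_btrees 'X _ _ (leqnn n)); last 2 first.
- by rewrite catalan0.
- move=> k; rewrite catalanS rmorph_sum.
  by apply: eq_bigr => i _; rewrite rmorphM.
rewrite /ascent_poly -big_enum (perm_big _ (alternating_gnc_enum n)) big_map.
rewrite big_seq [RHS]big_seq; apply: eq_bigr => b.
by rewrite mem_btrees // => /andP[vb /eqP nb]; rewrite ascents_lgraph_of.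
Qed.

Lemma horner_ascent_poly n : (ascent_poly n).[1] = #|alternating_gnc n|%:R.
Proof.
rewrite horner_sum (eq_bigr (fun=> 1)) ?sumr_const // => T _.
by rewrite hornerXn expr1n.
Qed.

Lemma coef_ascent_poly n r :
  (ascent_poly n)`_r = #|[set T in alternating_gnc n | ascents T == r]|%:R.
Proof.
rewrite coef_sum -sum1_card natr_sum [RHS](eq_bigl (fun T =>
  (T \in alternating_gnc n) && (ascents T == r))); last by move=> T; rewrite inE.
rewrite big_mkcondr /=; apply: eq_bigr => T _.
by rewrite coefXn eq_sym; case: eqP.
Qed.

Theorem theorem3p7 (n : nat) :
  (#|alternating_gnc n|%:R : rat) =
    \sum_(0 <= i < n.+1)
      (-1) ^+ (n - i) * 'C(i.+1, n - i)%:R * 2 ^+ i * catalan i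
  /\
  (forall r : nat, (r <= n)%N ->
    (#|[set T in alternating_gnc n | ascents T == r]|%:R : rat) =
      \sum_(0 <= i < n.+1) \sum_(0 <= j < n.+1)
        \sum_(0 <= k < n.+1 | (i + j + k == n)%N)
          (-1) ^+ (r + k) * 'C(i.+1, j)%:R * 'C(i.*2 + k, k)%:R
          * (if (j <= r)%N then 'C(k, r - j)%:R else 0)
          * 2 ^+ (i + k) * catalan i).
Proof.
split=> [|r _].
  rewrite -horner_ascent_poly ascent_polyE horner_sum big_mkord.
  apply: eq_bigr => -[i ni] _ /=.
  (* At t = 1 the parameter [w] vanishes, so only the last term, with k = 0 and j = n - i,
     survives. *)
  rewrite horner_sum big_ord_recr /= big1; last first.
    move=> -[j ji] _ /=; rewrite /tree_term hornerM.
    rewrite [X in _ * X](_ : _ = 0) ?mulr0 //.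
    rewrite hornerMn horner_exp !hornerE oppr0 expr0n.
    by rewrite (_ : (_ == _) = false) ?mul0rn //; lia.
  rewrite add0r subnn /tree_term expr0 addn0 bin0 mulr1n mulr1.
  rewrite !hornerM hornerMn !horner_exp hornerN hornerX hornerC.
  rewrite -[2 : {poly rat}]/(2%:R) -polyC_natr hornerC -mulr_natr; ring.
rewrite -coef_ascent_poly ascent_polyE coef_sum big_mkord.
apply: eq_bigr => -[i ni] _ /=; rewrite sum_diag // coef_sum.
apply: eq_bigr => j _; set k := (n - i - j)%N.
(* The dependence on t is t^j (1 - t)^k up to a constant, so the coefficient of t^r is that of
   t^(r-j) in (1 - t)^k. *)
have -> : tree_term (fun i => (catalan i)%:P) 'X i j k =
    (catalan i * 2 ^+ i * (-1) ^+ j * 'C(i.+1, j)%:R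
       * (-2) ^+ k * 'C(i.*2 + k, k)%:R)
    *: ('X^j * (1 + (-1) *: 'X) ^+ k).
  rewrite /tree_term -mul_polyC !rmorphM !rmorphXn /= !rmorphN !rmorph_nat /=.
  rewrite -[_ *+ 'C(i.+1, j)]mulr_natr -[_ *+ 'C(i.*2 + k, k)]mulr_natr.
  rewrite scaleN1r polyC1 [(- 'X) ^+ j]exprNn -[- (2 * _)]mulNr exprMn; ring.
rewrite coefZ coefXnM coef_exp_linear ltnNge; case: leqP => jr /=; last first.
  by rewrite !mulr0 !mul0r.
(* The signs with exponents j, k and r - j combine to the sign with exponent r + k. *)
rewrite -mulr_natr [(-2) ^+ k]exprNn !exprD -[in (-1) ^+ r](subnKC jr) exprD.
ring.
Qed.
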